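(* Let $K/k$ be a separable field extension of degree $6$ and let $\widetilde{K}/k$ be its Galois closure. Assume that $G=\operatorname{Gal}(\widetilde{K}/k)\simeq S_4$. (a) If $\operatorname{Gal}(\widetilde{K}/K)$ is isomorphic to the Klein four-group, there are two subgroups of order $2$ of $\operatorname{Gal}(\widetilde{K}/K)$ having a normal complement in $G$. Therefore, there are two almost classically Galois extensions $F/k$ of degree $12$ with $K\subset F\subset\widetilde{K}$. (b) If $\operatorname{Gal}(\widetilde{K}/K)$ is cyclic, there is a unique field $F$ with $K\subsetneq F\subsetneq\widetilde{K}$, and $F/k$ is not Hopf Galois.
   Context: A finite extension of fields $L/k$ is called Hopf Galois if there exists a finite cocommutative $k$-Hopf algebra $H$ such that $L$ is an $H$-module algebra and the $k$-linear map $j: L\otimes_k H\to \operatorname{End}_k(L)$, $j(s\otimes h)(t)=s(ht)$ for $h\in H$, $s,t\in L$, is bijective. Let $L/k$ be a finite separable extension with Galois closure $\widetilde{L}/k$, $\Gamma=\operatorname{Gal}(\widetilde{L}/k)$, $\Gamma'=\operatorname{Gal}(\widetilde{L}/L)$, and let $\lambda:\Gamma\to\operatorname{Sym}(\Gamma/\Gamma')$ be the left translation action on left cosets. $L/k$ is called almost classically Galois if there is a regular (i.e. sharply transitive) subgroup $N$ of $\operatorname{Sym}(\Gamma/\Gamma')$ which is normalized by $\lambda(\Gamma)$ and contained in $\lambda(\Gamma)$; equivalently, $\Gamma'$ has a normal complement in $\Gamma$. *)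

(* Defs.v *)
From HB Require Import structures.
From mathcomp Require Import all_boot all_order all_fingroup all_algebra.
From mathcomp Require Import all_solvable all_field.

Set Implicit Arguments.
Unset Strict Implicit.
Unset Printing Implicit Defensive.

Import GRing.Theory.
Local Open Scope ring_scope.

(* MathComp has no tensor product.  For finite-dimensional U and V, with bases *)
(* (e_i) and (f_j), we model U (x) V by matrices: the entry (i, j) is the      *)
(* coefficient of e_i (x) f_j.                                                 *)
Notation tensor U V := 'M[_]_(\dim (fullv : {vspace U}), \dim (fullv : {vspace V})).

Section Tensor.

Variables (k : fieldType) (U V : vectType k).

Definition tens (u : U) (v : V) : tensor U V :=
  \matrix_(i, j) (coord (vbasis fullv) i u * coord (vbasis fullv) j v).

(* For f bilinear, this is the linear map on U (x) V with u (x) v |-> f u v    *)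
(* (lemma tlift_tens); "tlift f (Delta h)" renders f applied to the Sweedler   *)
(* components of Delta h, i.e., \sum f h_(1) h_(2).                            *)
Definition tlift (W : lmodType k) (f : U -> V -> W) (t : tensor U V) : W :=
  \sum_i \sum_j t i j *: f (vbasis fullv)`_i (vbasis fullv)`_j.

Lemma tlift_is_linear (W : lmodType k) (f : U -> V -> W) : linear (tlift f).
Proof.
move=> a s t; rewrite /tlift scaler_sumr -big_split; apply: eq_bigr => i _ /=.
rewrite scaler_sumr -big_split; apply: eq_bigr => j _ /=.
by rewrite !mxE scalerDl scalerA.
Qed.

Lemma tlift_tens (W : lmodType k) (f : U -> V -> W) u v :
    (forall y, linear (f^~ y)) -> (forall x, linear (f x)) ->
  tlift f (tens u v) = f u v.
Proof.
move=> fl fr.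
have sumE (X : vectType k) (g : X -> W) x : linear g ->
  g x = \sum_i coord (vbasis fullv) i x *: g (vbasis fullv)`_i.
  move=> gl; pose G : {linear X -> W} :=
    HB.pack g (GRing.isLinear.Build k X W *:%R g gl).
  rewrite -[g]/(G : X -> W) {1}(coord_vbasis (memvf x)) linear_sum.
  by apply: eq_bigr => i _; rewrite linearZ.
rewrite (sumE _ (f^~ v)) //; apply: eq_bigr => i _.
rewrite (sumE _ (f _) v) // scaler_sumr.
by apply: eq_bigr => j _; rewrite mxE scalerA.
Qed.

Lemma tensor_sum (t : tensor U V) : t = tlift tens t.
Proof.
apply/matrixP => i j; rewrite summxE (bigD1 i) //= summxE (bigD1 j) //=.
have coordE (X : vectType k) (a b : 'I_(\dim (fullv : {vspace X}))) :
    coord (vbasis fullv) a (vbasis (fullv : {vspace X}))`_b = (b == a)%:R.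
  by rewrite coord_free ?(basis_free (vbasisP _)).
rewrite !mxE !coordE !eqxx !mulr1 !big1 ?addr0 // => [i' ne|j' ne].
  by rewrite summxE big1 // => j' _; rewrite !mxE !coordE (negPf ne) mul0r mulr0.
by rewrite !mxE !coordE (negPf ne) !mulr0.
Qed.

End Tensor.

Section HopfAlgebra.

Variables (k : fieldType) (H : falgType k).

Record hopf_structure := HopfStructure {
  comul : {linear H -> tensor H H};
  counit : {linear H -> k^o};
  antipode : {linear H -> H};
  comulA : forall h,
    tlift (fun a b => tlift (fun c d => tens (tens c d) b) (comul a)) (comul h)
    = tlift (fun a b => tlift (fun c d => tens (tens a c) d) (comul b)) (comul h);
  counitl : forall h, tlift (fun a b => counit a *: b) (comul h) = h;
  counitr : forall h, tlift (fun a b => counit b *: a) (comul h) = h;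
  comul1 : comul 1 = tens 1 1;
  comulM : forall g h, comul (g * h) =
    tlift (fun a b => tlift (fun c d => tens (a * c) (b * d)) (comul h)) (comul g);
  counit1 : counit 1 = 1;
  counitM : forall g h, counit (g * h) = counit g * counit h;
  antipodel : forall h, tlift (fun a b => antipode a * b) (comul h) = (counit h)%:A;
  antipoder : forall h, tlift (fun a b => a * antipode b) (comul h) = (counit h)%:A
}.

Definition cocommutative (S : hopf_structure) :=
  forall h, tlift (fun a b => tens b a) (comul S h) = comul S h.

Variable L : falgType k.

Definition module_algebra (S : hopf_structure) (act : {linear H -> 'End(L)}) :=
  [/\ forall x, act 1 x = x,
      forall g h x, act (g * h) x = act g (act h x),
      forall h, act h 1 = counit S h *: 1
    & forall h x y,
        act h (x * y) = tlift (fun a b => act a x * act b y) (comul S h)].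

Definition hopf_galois_map (act : {linear H -> 'End(L)}) : tensor L H -> 'End(L) :=
  tlift (fun s h => (amull s \o act h)%VF).

Lemma hopf_galois_map_tens act s h t :
  hopf_galois_map act (tens s h) t = s * act h t.
Proof.
rewrite /hopf_galois_map tlift_tens => [|y a u v|x a u v].
- by rewrite comp_lfunE lfunE.
- by rewrite linearP /= comp_lfunDl comp_lfunZl.
- by rewrite linearP /= comp_lfunDr comp_lfunZr.
Qed.

End HopfAlgebra.

Definition hopf_galois (k : fieldType) (L : fieldExtType k) :=
  exists (H : falgType k) (S : hopf_structure H) (act : {linear H -> 'End(L)}),
    [/\ cocommutative S, module_algebra S act & bijective (hopf_galois_map act)].

Section GroupTheory.

Variables (gT : finGroupType).
Implicit Types G H : {group gT}.

Definition has_normal_complement G H :=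
  [exists N : {group gT}, (N <| G)%g && (N \in [complements to H in G])%g].

(* The permutations of the cosets of H in G are those of {set gT} that fix     *)
(* everything outside rcosets H G; the group of translations is the image of G.*)
Definition translations G H : {group {perm {set gT}}} :=
  (actperm <[actsRs_rcosets H G]> @* G)%G.

Definition regular_perm_group (T : finType) (N : {group {perm T}}) (X : {set T}) :=
  N \subset perm.Sym X
  /\ forall x y, x \in X -> y \in X -> exists! n, n \in N /\ n x = y.

End GroupTheory.

Section AlmostClassicallyGalois.

Variables (k : fieldType) (L : splittingFieldType k).
Implicit Types K E F : {subfield L}.

Definition galois_closure K E :=
  [/\ (K <= E)%VS, galois 1 E
    & forall M : {subfield L}, (K <= M)%VS -> galois 1 M -> (E <= M)%VS].

(* In gal_of E, x * y is "first x, then y", the reverse of composition of      *)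
(* functions.  So the left coset g \o Gal(E / F) is the MathComp right coset   *)
(* 'Gal(E / F) :* g, and left translation by g is X |-> X :* g.                *)
Definition almost_classically_galois F :=
  exists E : {subfield L},
    galois_closure F E
    /\ exists N : {group {perm {set gal_of E}}},
         let lambda := translations 'Gal(E / 1) 'Gal(E / F) in
         [/\ regular_perm_group N (rcosets 'Gal(E / F) 'Gal(E / 1)),
             lambda \subset 'N(N)%g & N \subset lambda].

End AlmostClassicallyGalois.

(* Main.v *)
(* If H makes M/k Hopf Galois and L contains the Galois closure of M, then      *)
(* L (x) H is a bialgebra over L acting on Hom_k(M, L) from the right, and      *)
(* r |-> f r is bijective for every k-embedding f.  The r that send one         *)
(* embedding to another are exactly the group-like elements, so they form a     *)
(* group N that is sharply transitive on the embeddings, and Gal(L/k)           *)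
(* normalizes it (one direction of the Greither-Pareigis theorem).              *)
(*   In part (b), the field fixed by t = c^2, with c a 4-cycle, would give such *)
(* an N of order 12 normalized by S_4, acting on 12 points with stabilizer      *)
(* <t>.  The centralizer V of t in N has order 4.  By Frobenius' theorem, N     *)
(* has either exactly 3 solutions of x^3 = 1, or exactly 4 of x^4 = 1.  In the  *)
(* first case they form a group of order 3, which is centralized by the square  *)
(* t, although 3 does not divide |V|.  In the second case they form V, which    *)
(* is then S_4-stable.  The crossed homomorphism S_4 -> N given by the orbit    *)
(* of a point shows that a 3-cycle s centralizes V; as 3 divides |C_N(s)|, s    *)
(* centralizes N, and so does t, which is a product of conjugates of s.         *)
(*   In part (a), the only subgroup of index 2 in S_4 consists of the squares,  *)
(* so a subgroup of order 2 has a normal complement if and only if its          *)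
(* generator is not a square; Gal(E / K) is not normal, so it contains exactly  *)
(* two such elements.                                                           *)
From HB Require Import structures.
Require Import Defs.
From mathcomp Require Import all_boot all_order all_fingroup all_algebra.
From mathcomp Require Import all_solvable all_field.
From mathcomp Require Import zify.

Set Implicit Arguments.
Unset Strict Implicit.
Unset Printing Implicit Defensive.

Import GRing.Theory.

(** * Group-like elements of L (x) H *)

(** For an algebra map f from M to L, the Hopf Galois condition makes r |-> [hact r f] a bijection
    from L (x) H onto Hom_k(M, L) ([hact_surj], [hact_inj]), and [hact r f] is again an algebra map
    exactly when r is group-like. So the group-like rows permute the embeddings of M sharply
    transitively, and Galois elements normalize this group by acting on coefficients
    ([hopf_galois_regular]). Once embeddings are identified with cosets, part (b) says that S_4,
    acting on the cosets of the square t of a 4-cycle, normalizes no regular group N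
    ([S4_no_regular]). The crossed homomorphism [cc] compares S_4 with N: it shows that C_N(t) has
    order 4, and later forces t to centralize N. Part (a) becomes group theory through
    [regular_translationsP]; a normal complement of a subgroup of order 2 can only be the set of
    squares, which leads to the count in [card_complemented_order2]. Minimality of the Galois
    closure enters through [galois_closure_core_trivial], which makes the coset action faithful and
    Gal(E / K) non-normal. *)

Section HopfAction.

Local Open Scope ring_scope.

Lemma coord_lfun (k : fieldType) (V W : vectType k) i (w : W) :
  {A : 'Hom(V, W) | forall v, A v = coord (vbasis {:V}) i v *: w}.
Proof.
have lin : linear (fun v : V => coord (vbasis {:V}) i v *: w).
  by move=> a u v; rewrite linearP scalerDl scalerA.
pose G : {linear V -> W} := HB.pack (fun v : V => coord (vbasis {:V}) i v *: w)
  (GRing.isLinear.Build k V W *:%R _ lin).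
by exists (linfun G) => v; rewrite lfunE.
Qed.

Variables (k : fieldType) (M L : fieldExtType k) (H : falgType k).
Variables (S : hopf_structure H) (act : {linear H -> 'End(M)}).
Hypothesis actS : module_algebra S act.
Hypothesis bij_act : bijective (hopf_galois_map act).

Let m := \dim {:H}.
Let h_ (i : 'I_m) : H := (vbasis {:H})`_i.

(* The row r stands for \sum_i r_i (x) h_i in L (x) H, and hact r f for its    *)
(* right action on f in Hom_k(M, L) = Hom_L(L (x) M, L), transposed from the  *)
(* action of L (x) H on L (x) M.                                              *)
Definition hact (r : 'rV[L]_m) (f : 'Hom(M, L)) : 'Hom(M, L) :=
  \sum_i (amull (r 0 i) \o (f \o act (h_ i)))%VF.

Lemma hactE r f t : hact r f t = \sum_i r 0 i * f (act (h_ i) t).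
Proof.
by rewrite sum_lfunE; apply: eq_bigr => i _; rewrite !comp_lfunE lfunE.
Qed.

Let n := \dim {:M}.
Let b_ (j : 'I_n) : M := (vbasis {:M})`_j.

Lemma hbasis_expand (x : H) : x = \sum_i coord (vbasis {:H}) i x *: h_ i.
Proof. exact: coord_vbasis (memvf x). Qed.

(** Let T_j be the preimage under [hopf_galois_map] of the j-th coordinate form, with values in k
    inside M. Applying f to the coefficients of T_j gives a row sending f to that form; these rows
    are combined with the coefficients g(b_j). The boolean equality lets [xchoose] pick r later. *)
Lemma hact_surj (f : 'AHom(M, L)) (g : 'Hom(M, L)) : exists r, hact r f == g.
Proof.
have [inv invK invK'] := bij_act.
pose T j := inv (sval (coord_lfun j (1 : M))).
exists (\row_i \sum_j g (b_ j) * \sum_a f (b_ a) * (T j a i)%:A).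
apply/eqP/lfunP=> t; rewrite hactE.
transitivity (\sum_j g (b_ j) * f (hopf_galois_map act (T j) t)); last first.
  rewrite [in RHS](coord_vbasis (memvf t)) linear_sum /=.
  apply: eq_bigr => j _; rewrite invK' (svalP (coord_lfun j _)).
  by rewrite !linearZ /= rmorph1 -scalerAr mulr1.
under eq_bigr => i _ do rewrite mxE mulr_suml.
rewrite exchange_big /=; apply: eq_bigr => j _.
under eq_bigr => i _ do rewrite -mulrA.
rewrite -mulr_sumr; congr (_ * _).
rewrite /hopf_galois_map /tlift sum_lfunE linear_sum /=.
under eq_bigr => i _ do rewrite mulr_suml.
rewrite exchange_big /=; apply: eq_bigr => a _.
rewrite sum_lfunE linear_sum /=; apply: eq_bigr => i _.
rewrite scale_lfunE comp_lfunE lfunE /= linearZ /= rmorphM /=.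
by rewrite -!scalerAr mulr1 -scalerAl.
Qed.

(** Bijectivity of [hopf_galois_map] equates dim M * dim H with (dim M)^2. *)
Lemma dim_hopf : m = n.
Proof.
pose F := linfun (hopf_galois_map act : _ -> _).
have FE t : F t = hopf_galois_map act t.
  pose G : {linear _ -> _} := HB.pack (hopf_galois_map act)
    (GRing.isLinear.Build k _ _ *:%R (hopf_galois_map act) (tlift_is_linear _)).
  by rewrite /F (lfunE G).
have injF : injective F by move=> x y; rewrite !FE; apply: (bij_inj bij_act).
have/eqP kF : lker F == 0%VS by apply/lker0P.
have := limg_ker_dim F fullv; rewrite kF capv0 dimv0 add0n.
have -> : limg F = fullv.
  apply/eqP; rewrite eqEsubv subvf; apply/subvP => x _.
  have [inv _ invK] := bij_act.
  by rewrite -[x]invK -FE memv_img ?memvf.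
rewrite !dimvf dim_matrix => /eqP.
rewrite [dim _](_ : _ = dim M * dim M)%N // -!dimvf eqn_pmul2l ?adim_gt0 //.
by move/eqP.
Qed.

(** In coordinates r |-> [hact r f] is multiplication by the matrix [Psi], which has full rank by
    [hact_surj] and is square by [dim_hopf]. *)
Lemma hact_inj (f : 'AHom(M, L)) r : hact r f = 0 -> r = 0.
Proof.
pose Psi : 'M[L]_(m, n) := \matrix_(i, j) f (act (h_ i) (b_ j)).
have PsiE s : s *m Psi = \row_j hact s f (b_ j).
  by apply/rowP => j; rewrite !mxE hactE; apply: eq_bigr => i _; rewrite mxE.
have full : row_full Psi.
  rewrite -sub1mx; apply/row_subP => j; rewrite row1.
  have [s /eqP Ds] := hact_surj f (sval (coord_lfun j (1 : L))).
  apply/submxP; exists s; rewrite PsiE Ds; apply/rowP => i.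
  rewrite !mxE (svalP (coord_lfun j _)) coord_free ?(basis_free (vbasisP _)) //.
  by rewrite eqxx; case: eqP; rewrite ?scale1r ?scale0r.
have free : row_free Psi by rewrite /row_free (eqP full) dim_hopf.
move=> r0; apply: (row_free_inj free); rewrite mul0mx PsiE r0.
by apply/rowP=> j; rewrite !mxE lfunE.
Qed.

Lemma hact_unique (f : 'AHom(M, L)) r s : hact r f = hact s f -> r = s.
Proof.
move=> eq_rs; apply/eqP; rewrite -subr_eq0; apply/eqP/(@hact_inj f).
apply/lfunP=> t; rewrite lfunE /= hactE.
under eq_bigr => i _ do rewrite !mxE mulrBl.
by rewrite sumrB -!hactE eq_rs subrr.
Qed.

Definition group_like (r : 'rV[L]_m) :=
  \sum_i r 0 i * (counit S (h_ i))%:A = 1 /\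
  forall p q, \sum_i r 0 i * (comul S (h_ i) p q)%:A = r 0 p * r 0 q.

Lemma hact_group_like (f g : 'AHom(M, L)) r : hact r f = g -> group_like r.
Proof.
case: actS => _ _ act_1 act_M Dg; split=> [|p q].
  transitivity (g 1); last by rewrite rmorph1.
  rewrite -Dg hactE; apply: eq_bigr => i _.
  by rewrite act_1 linearZ /= rmorph1.
(* Multiplicativity of g says that Z, applied to f (x) f, kills every t (x) u. Injectivity of the
   action on f, used once in each tensor factor, then gives Z = 0. *)
pose Z p q := \sum_i r 0 i * (comul S (h_ i) p q)%:A - r 0 p * r 0 q.
suffices Z0 : forall p, \row_q Z p q = 0.
  by have /rowP/(_ q) := Z0 p; rewrite !mxE => /eqP; rewrite subr_eq0 => /eqP.
move=> {}p; apply: (@hact_inj f); apply/lfunP => u; rewrite hactE lfunE /=.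
under eq_bigr => i _ do rewrite mxE.
suffices: \row_p (\sum_q Z p q * f (act (h_ q) u)) = 0.
  by move/rowP/(_ p); rewrite !mxE.
apply: (@hact_inj f); apply/lfunP => t; rewrite hactE lfunE /=.
under eq_bigr => i _ do rewrite mxE.
have: g (t * u) = g t * g u by rewrite rmorphM.
rewrite -Dg !hactE => /eqP; rewrite -subr_eq0 => /eqP Eg; rewrite -[RHS]Eg.
under eq_bigr => i _ do rewrite mulr_suml.
under [X in _ = X - _]eq_bigr => i _.
  rewrite act_M /tlift !linear_sum mulr_sumr.
  under eq_bigr => a _ do rewrite !linear_sum mulr_sumr.
  over.
rewrite [X in _ = X - _]exchange_big /= mulr_suml -sumrB; apply: eq_bigr => a _.
rewrite [X in _ = X - _]exchange_big mulr_sumr -sumrB /=; apply: eq_bigr => c _.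
rewrite /Z !mulrBl !mulr_suml; congr (_ - _); last first.
  by rewrite mulrACA -mulrA [f _ * f _]mulrC.
apply: eq_bigr => i _; rewrite linearZ /= rmorphM /= -!mulrA [f _ * f _]mulrC.
by rewrite mulr_algl.
Qed.

Lemma group_like_hact (f : 'AHom(M, L)) r :
  group_like r -> exists g : 'AHom(M, L), hact r f = g.
Proof.
case: actS => _ _ act_1 act_M [r1 rM].
suffices fM : ahom_in {:M} (hact r f) by exists (AHom fM).
apply/ahom_inP; split=> [t u _ _|]; last first.
  rewrite -r1 hactE; apply: eq_bigr => i _.
  by rewrite act_1 linearZ /= rmorph1.
rewrite !hactE.
under eq_bigr => i _.
  rewrite act_M /tlift !linear_sum mulr_sumr.
  under eq_bigr => a _ do rewrite !linear_sum mulr_sumr.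
  over.
rewrite exchange_big /= mulr_suml; apply: eq_bigr => a _.
rewrite exchange_big mulr_sumr /=; apply: eq_bigr => c _.
rewrite mulrACA -rM mulr_suml; apply: eq_bigr => i _.
by rewrite linearZ /= rmorphM /= -mulrA mulr_algl.
Qed.

(** Here t is the product of r and s in L (x) H, so it does not depend on f. *)
Lemma hact_comp r s : exists t, forall f, hact s (hact r f) = hact t f.
Proof.
case: actS => _ act_M _ _.
exists (\row_l \sum_j \sum_i
  s 0 j * (r 0 i * (coord (vbasis {:H}) l (h_ i * h_ j))%:A)) => f.
apply/lfunP=> x; rewrite !hactE.
under [RHS]eq_bigr => l _.
  rewrite mxE mulr_suml; under eq_bigr => j _ do rewrite mulr_suml.
  over.
rewrite exchange_big; apply: eq_bigr => j _ /=.
rewrite hactE mulr_sumr exchange_big; apply: eq_bigr => i _ /=.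
rewrite -act_M [in LHS](hbasis_expand (h_ i * h_ j)).
rewrite linear_sum sum_lfunE linear_sum !mulr_sumr; apply: eq_bigr => l _ /=.
by rewrite linearZ scale_lfunE linearZ /= -!mulrA mulr_algl.
Qed.

Lemma hact_id : exists r, forall f, hact r f = f.
Proof.
case: actS => act_1 _ _ _.
exists (\row_l (coord (vbasis {:H}) l 1)%:A) => f; apply/lfunP => x.
rewrite hactE -[in RHS](act_1 x) [in RHS](hbasis_expand 1).
rewrite linear_sum sum_lfunE linear_sum; apply: eq_bigr => l _ /=.
by rewrite mxE linearZ scale_lfunE linearZ /= mulr_algl.
Qed.

Lemma hact_conj (s : 'AEnd(L)) r f :
  (s \o hact r f)%VF = hact (map_mx s r) (s \o f)%VF.
Proof.
apply/lfunP=> x; rewrite comp_lfunE !hactE linear_sum.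
by apply: eq_bigr => i _; rewrite mxE rmorphM comp_lfunE.
Qed.

End HopfAction.

(** * From a Hopf Galois structure to a regular permutation group *)

Section RegularGroup.

Local Open Scope ring_scope.

Variables (k : fieldType) (M L : fieldExtType k).
Variables (T : finType) (X : {set T}) (e : T -> 'AHom(M, L)).
Hypothesis inj_e : {in X &, injective e}.
Hypothesis surj_e : forall f, exists2 x, x \in X & e x = f.

Lemma hopf_galois_regular : X != set0 -> hopf_galois M ->
  exists N : {group {perm T}}, regular_perm_group N X
    /\ forall (s : 'AEnd(L)) (p : {perm T}), perm_on X p ->
         {in X, forall x, e (p x) = (s \o e x)%AF} -> p \in 'N(N)%g.
Proof.
case/set0Pn=> x0 Xx0 [H [S [act [_ actS bij_act]]]].
pose represents r (q : {perm T}) := {in X, forall x, hact act r (e x) = e (q x)}.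
pose rep f (g : 'Hom(M, L)) := xchoose (hact_surj bij_act f g).
have repE f g : hact act (rep f g) f = g by apply/eqP/(xchooseP (hact_surj _ f g)).
(* A single row must represent q at every point. By [hact_unique] it can only be the row found at
   x0, which makes membership decidable. *)
pose N0 : {set {perm T}} := [set q : {perm T} | perm_on X q &&
  [forall x in X, hact act (rep (e x0) (e (q x0))) (e x) == e (q x)]].
have N0P q : reflect (perm_on X q /\ exists r, represents r q) (q \in N0).
  rewrite inE; apply: (iffP andP) => -[Xq rq]; split=> //.
    exists (rep (e x0) (e (q x0))) => x Xx.
    by have /forallP/(_ x) := rq; rewrite Xx => /eqP.
  case: rq => r rq; apply/forall_inP => x Xx; apply/eqP.
  rewrite -(rq x Xx); congr hact; apply: (hact_unique bij_act (f := e x0)).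
  by rewrite repE rq.
have uniqN (p q : {perm T}) r : perm_on X p -> perm_on X q ->
    represents r p -> represents r q -> p = q.
  move=> Xp Xq rp rq; apply/permP => x.
  have [Xx|nXx] := boolP (x \in X); last by rewrite (out_perm Xp) ?(out_perm Xq).
  apply: inj_e; rewrite ?perm_closed //; apply: val_inj.
  by rewrite /= -rp // -rq.
have permN (r : 'rV[L]_(\dim {:H})) : group_like S r ->
    exists2 q, perm_on X q & represents r q.
  move=> rG.
  have next s x : group_like S s -> exists y, (y \in X) && (hact act s (e x) == e y).
    move=> sG; have [g Dg] := group_like_hact actS (e x) sG.
    by have [y Xy Dy] := surj_e g; exists y; rewrite Xy Dg -Dy eqxx.
  pose nu x := if x \in X then xchoose (next r x rG) else x.
  have nuX x : x \in X -> (nu x \in X) /\ hact act r (e x) = e (nu x).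
    rewrite /nu => Xx; rewrite Xx; have /andP[-> /eqP //] := xchooseP (next r x rG).
  have inj_nu : injective nu.
    move=> x y; have [Xx|nXx] := boolP (x \in X); last first.
      rewrite {1}/nu (negPf nXx) /nu; case: ifP => // Xy Dx.
      have [] := nuX y Xy; rewrite /nu Xy -Dx => XDx.
      by rewrite XDx in nXx.
    have [Xy|nXy] := boolP (y \in X); last first.
      rewrite {2}/nu (negPf nXy) /nu; case: ifP => // _ Dy.
      have [] := nuX x Xx; rewrite /nu Xx Dy => XDy.
      by rewrite XDy in nXy.
    move=> eq_xy; have [[Xnx Dx] [_ Dy]] := (nuX x Xx, nuX y Xy).
    (* Acting by r and then by s fixes e x, so by uniqueness the product is the identity row; hence
       s undoes r on e y too. *)
    pose s := rep (e (nu x)) (e x).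
    have [t Dt] := hact_comp actS r s; have [u Du] := hact_id L actS.
    have tE : t = u.
      by apply: (hact_unique bij_act (f := e x)); rewrite -Dt Du Dx repE.
    apply: inj_e => //; apply: val_inj; rewrite /= -(Du (e y)) -tE -Dt Dy -eq_xy.
    by rewrite repE.
  exists (perm inj_nu) => [|x Xx]; last by rewrite permE; case: (nuX x Xx).
  by apply/subsetP => x; apply: contraR => nXx; rewrite permE /nu (negPf nXx).
have N0group : group_set N0.
  apply/group_setP; split=> [|p q /N0P[Xp [r rp]] /N0P[Xq [s sq]]].
    apply/N0P; split; first exact: perm_on1.
    have [u Du] := hact_id L actS; exists u => x Xx.
    by rewrite Du perm1.
  apply/N0P; split; first exact: perm_onM.
  have [t Dt] := hact_comp actS r s; exists t => x Xx.
  by rewrite -Dt rp // sq ?perm_closed // permM.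
exists (group N0group); split; first split.
- by apply/subsetP=> q /N0P[Xq _]; rewrite inE.
- move=> x y Xx Xy; have Dy := repE (e x) (e y).
  have [q Xq rq] := permN _ (hact_group_like actS bij_act Dy).
  exists q; split=> [|p [/N0P[Xp [r rp]] pxy]].
    split; first by apply/N0P; split=> //; exists (rep (e x) (e y)).
    apply: inj_e; rewrite ?perm_closed //.
    by apply: val_inj; rewrite /= -rq.
  apply: uniqN rq _ => //; rewrite (_ : rep _ _ = r) //.
  by apply: (hact_unique bij_act (f := e x)); rewrite Dy rp // pxy.
move=> s p Xp ps; rewrite inE; apply/subsetP=> _ /imsetP[q /N0P[Xq [r rq]] ->].
apply/N0P; split; first by rewrite !perm_onM // perm_onV.
exists (map_mx s r) => x Xx; rewrite conjgE !permM.
have XVx : (p^-1)%g x \in X by rewrite perm_closed // perm_onV.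
have -> : ahval (e x) = (s \o e ((p^-1)%g x))%VF by rewrite -[in LHS](permKV p x) ps.
rewrite ps ?(perm_closed _ Xq) //.
apply: etrans (esym (hact_conj act s r (e ((p^-1)%g x)))) _.
by congr (_ \o _)%VF; apply: rq.
Qed.

End RegularGroup.

(** * The symmetric group S_4 *)

Section SymmetricGroup4.

Import GroupScope.

(* Permutations of {0, 1, 2, 3} as lists of values, so that statements about  *)
(* S_4 can be decided by evaluation; the product is "first a, then b", as in  *)
(* {perm 'I_4}.                                                               *)
Definition codes4 : seq (seq nat) := permutations (iota 0 4).
Definition cmul (a b : seq nat) := [seq nth 0 b i | i <- a].
Definition cone := iota 0 4.

Lemma isog_S4_code (gT : finGroupType) (G : {group gT}) :
    G \isog [set: {perm 'I_4}] ->
  exists code : gT -> seq nat,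
    [/\ {in G &, injective code}, {in G &, {morph code : x y / x * y >-> cmul x y}},
        code 1 = cone, {in G, forall x, code x \in codes4}
      & {in codes4, forall a, exists2 x, x \in G & code x = a}].
Proof.
case/isogP=> f injf imf.
pose code4 (p : {perm 'I_4}) := [seq (p i : nat) | i <- enum 'I_4].
have code4E p (i : 'I_4) : nth 0 (code4 p) i = p i.
  by rewrite (nth_map i) ?size_enum_ord // nth_ord_enum.
have size4 p : size (code4 p) = 4 by rewrite size_map size_enum_ord.
have code4_inj : injective code4.
  by move=> p q eq_pq; apply/permP=> i; apply/val_inj; rewrite /= -!code4E eq_pq.
have mem4 p : code4 p \in codes4.
  rewrite mem_permutations; apply: uniq_perm; rewrite ?iota_uniq //.
    rewrite map_inj_uniq ?enum_uniq // => i j /val_inj; exact: perm_inj.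
  have uniq4 : uniq (code4 p).
    rewrite map_inj_uniq ?enum_uniq // => i j /val_inj; exact: perm_inj.
  have [||//] := uniq_min_size uniq4 (s2 := iota 0 4).
    by move=> _ /mapP[i _ ->]; rewrite mem_iota /= add0n ltn_ord.
  by rewrite size4.
exists (code4 \o f); split=> [x y Gx Gy /code4_inj | x y Gx Gy | | x _ | a].
- by move/(injmP injf); apply.
- rewrite /= morphM //; apply: (@eq_from_nth _ 0).
    by rewrite [RHS]size_map !size4.
  rewrite size4 => i lti; rewrite (nth_map 0) ?size4 //.
  by rewrite (code4E _ (Ordinal lti)) permM (code4E _ (Ordinal lti)) code4E.
- by rewrite /= morph1 /code4 (eq_map (g := val)) ?val_enum_ord // => i; rewrite perm1.
- exact: mem4.
pose im4 := [seq code4 p | p : {perm 'I_4}].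
have uniq4 : uniq im4 by rewrite map_inj_uniq ?enum_uniq.
have sub4 : {subset im4 <= codes4} by move=> _ /mapP[p _ ->].
have [| _ <-] := uniq_min_size uniq4 sub4.
  rewrite size_map -cardE -cardsT (_ : [set: {perm 'I_4}] = perm.Sym [set: 'I_4]); last first.
    by apply/setP=> p; rewrite !inE; apply/esym/subsetP=> i.
  by rewrite perm.card_Sym cardsT card_ord.
case/mapP=> p _ ->; have : p \in f @* G by rewrite imf inE.
by case/morphimP=> x _ Gx ->; exists x.
Qed.

Variables (gT : finGroupType) (G : {group gT}).
Hypothesis isoG : G \isog [set: {perm 'I_4}].

Lemma card_code_count (code : gT -> seq nat) (P : pred (seq nat)) :
    {in G &, injective code} -> {in G, forall x, code x \in codes4} ->
    {in codes4, forall a, exists2 x, x \in G & code x = a} ->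
  #|[set x in G | P (code x)]| = count P codes4.
Proof.
move=> inj mem surj; rewrite cardE -(size_map code) -size_filter.
apply: perm_size; apply: uniq_perm.
- rewrite map_inj_in_uniq ?enum_uniq // => x y.
  by rewrite !mem_enum !inE => /andP[Gx _] /andP[Gy _]; apply: inj.
- by rewrite filter_uniq ?permutations_uniq.
move=> a; rewrite mem_filter; apply/mapP/andP=> [[x] | [Pa /surj[x Gx Dx]]].
  by rewrite mem_enum inE => /andP[Gx Px] ->; rewrite mem.
by exists x; rewrite ?Dx // mem_enum inE Gx Dx.
Qed.

(** The squares are the identity, three double transpositions and eight 3-cycles. *)
Lemma S4_squares : #|[set y ^+ 2 | y in G]| = 12.
Proof.
have [code [inj M c1 mem surj]] := isog_S4_code isoG.
have <- : [set x in G | has (fun b => cmul b b == code x) codes4] = [set y ^+ 2 | y in G].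
  apply/setP=> x; rewrite inE; apply/andP/imsetP=> [[Gx /hasP[_ /surj[y Gy <-]]] | [y Gy ->]].
    by rewrite -M // => /eqP/inj <-; rewrite ?groupM //; exists y.
  rewrite groupX //; split=> //; apply/hasP; exists (code y); rewrite ?mem //.
  by rewrite -M // expgS expg1.
by rewrite (card_code_count (fun a => has (fun b => cmul b b == a) codes4)).
Qed.

(** The condition on y discards the 3-cycles and leaves the normal Klein four-group. *)
Lemma S4_klein : #|[set y ^+ 2 | y in G & y ^+ 4 == 1]| = 4.
Proof.
have [code [inj M c1 mem surj]] := isog_S4_code isoG.
pose P a b := (cmul b b == a) && (cmul a a == cone).
have <- : [set x in G | has (P (code x)) codes4] = [set y ^+ 2 | y in G & y ^+ 4 == 1].
  apply/setP=> x; rewrite inE; apply/andP/imsetP=> [[Gx /hasP[_ /surj[y Gy <-]]] | [y]].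
    rewrite /P -!M // -c1 => /andP[/eqP/inj Dx /eqP/inj Dx2].
    have y2 : y ^+ 2 = x by rewrite expgS expg1 Dx ?groupM.
    exists y; last by rewrite y2.
    by rewrite inE Gy -[4]/(2 * 2)%N expgM y2 expgS expg1 Dx2 ?groupM ?group1 ?eqxx.
  rewrite inE => /andP[Gy /eqP y4] ->; rewrite groupX //; split=> //; apply/hasP.
  exists (code y); rewrite ?mem // /P -!M ?groupX // -expgD y4 c1.
  by rewrite expgS expg1 !eqxx.
by rewrite (card_code_count (fun a => has (P a) codes4)).
Qed.

(** The centralizer of a double transposition is dihedral of order 8. *)
Lemma S4_square_cent c : c \in G -> c ^+ 2 != 1 -> c ^+ 4 = 1 ->
  #|'C_G[c ^+ 2]| = 8.
Proof.
have [code [inj M c1 mem surj]] := isog_S4_code isoG.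
move=> Gc c2 c4.
pose P a b := (cmul (cmul a a) b == cmul b (cmul a a)).
rewrite (_ : 'C_G[c ^+ 2] = [set x in G | P (code c) (code x)]); last first.
  apply/setP=> x; rewrite in_setI [in RHS]inE cent1C; case Gx: (x \in G) => //=.
  rewrite /P -!M ?(@groupM _ G) // -[(c * c)%g]/(c ^+ 2).
  by apply/cent1P/eqP=> [-> // | /inj]; apply; rewrite !(groupM, groupX).
rewrite card_code_count //.
have: all (fun a => [&& cmul a a != cone & cmul (cmul a a) (cmul a a) == cone] ==>
                    (count (P a) codes4 == 8)) codes4 by vm_compute.
move/allP/(_ _ (mem _ Gc)); rewrite -!M ?groupM // -c1 !(inj_in_eq inj) ?groupM //.
by rewrite -[c * c]/(c ^+ 2) c2 -expgD c4 eqxx => /eqP.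
Qed.

(* For c = (0 1 2 3), one may take d = (0 2), u = (0 1)(2 3), and s a product *)
(* of two transpositions that share a point.                                  *)
Lemma S4_witnesses c : c \in G -> c ^+ 2 != 1 -> c ^+ 4 = 1 ->
  exists d g a b x y, let u := (c ^+ 2) ^ g in let s := d ^ a * d ^ b in
    [/\ [/\ d \in G, g \in G, a \in G & b \in G] /\ (x \in G /\ y \in G),
        [/\ d ^+ 2 = 1, d * c ^+ 2 = c ^+ 2 * d, d != 1 & d != c ^+ 2],
        [/\ u * c ^+ 2 = c ^+ 2 * u, u != 1, u != c ^+ 2 & d != u],
        d != c ^+ 2 * u /\ u ^ d \in [:: u; c ^+ 2 * u]
      & [/\ s != 1, s ^+ 3 = 1 & s ^ x * s ^ y = c ^+ 2]].
Proof.
have [code [inj M c1 mem surj]] := isog_S4_code isoG.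
move=> Gc c2 c4; have Gt : c ^+ 2 \in G by rewrite groupX.
pose cinv a := [seq index i a | i <- iota 0 4].
pose cconj a b := cmul (cinv b) (cmul a b).
have codeV z : z \in G -> code z^-1 = cinv (code z).
  move=> Gz; have: all (fun a => all (fun b => (cmul a b == cone) ==> (b == cinv a)) codes4)
    codes4 by vm_compute.
  move/allP/(_ _ (mem _ Gz))/allP/(_ (code z^-1)); rewrite mem ?groupV // -M ?groupV //.
  by rewrite mulgV c1 eqxx => /(_ isT)/eqP.
have codeJ z w : z \in G -> w \in G -> code (z ^ w) = cconj (code z) (code w).
  by move=> Gz Gw; rewrite conjgE !M ?codeV ?groupM ?groupV.
have code_eq z w : z \in G -> w \in G -> (code z == code w) = (z == w).
  exact: inj_in_eq inj z w.
pose Q t d := [&& cmul d d == cone, cmul d t == cmul t d, d != cone & d != t].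
pose Q' t d u := [&& cmul u t == cmul t u, u != cone, u != t, d != u, d != cmul t u
  & cconj u d \in [:: u; cmul t u]].
pose ord3 s := (s != cone) && (cmul s (cmul s s) == cone).
(* [if] rather than [==>] and [&&], which would be evaluated eagerly. *)
have: all (fun t => if (cmul t t == cone) && (t \in [seq cmul a a | a <- codes4]) then
   all (fun s => if ord3 s then
     has (fun x => has (fun y => cmul (cconj s x) (cconj s y) == t) codes4) codes4
   else true) codes4 else true) codes4 by vm_compute.
move/allP/(_ _ (mem _ Gt)); rewrite ifT => [sP|]; last first.
  rewrite -M // -expgD c4 c1 eqxx expgS expg1 M //.
  by apply: (map_f (fun a => cmul a a)); apply: mem.
(* By the previous computation t is a product of two conjugates of any element of order 3, so it
   remains to find d, u and one such s. *)
have: all (fun c => if (cmul c c != cone) && (cmul (cmul c c) (cmul c c) == cone) then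
   has (fun d => if Q (cmul c c) d then
     has (fun g => Q' (cmul c c) d (cconj (cmul c c) g)) codes4
     && has (fun a => has (fun b => ord3 (cmul (cconj d a) (cconj d b))) codes4) codes4
   else false) codes4 else true) codes4 by vm_compute.
move/allP/(_ _ (mem _ Gc)); rewrite -M // -[(c * c)%g]/(c ^+ 2) ifT; last first.
  by rewrite -M // -c1 !code_eq ?groupM // c2 -expgD c4 eqxx.
case/hasP=> _ /surj[d Gd <-]; case: ifP => // /and4P[d2 dt d1 d't] /andP[].
case/hasP=> _ /surj[g Gg <-] uP /hasP[_ /surj[a Ga <-]] /hasP[_ /surj[b Gb <-]].
move: uP; rewrite -!codeJ // -M ?groupJ //.
set u := (c ^+ 2) ^ g; have Gu : u \in G by rewrite groupJ.
set s := d ^ a * d ^ b; have Gs : s \in G by rewrite groupM ?groupJ.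
move=> uP s3P; have := allP sP _ (mem _ Gs); rewrite s3P.
case/hasP=> _ /surj[x Gx <-] /hasP[_ /surj[y Gy <-]] xyP; exists d, g, a, b, x, y.
have Gut : c ^+ 2 * u \in G by rewrite groupM.
move: d2 dt d1 d't; rewrite -!M // -c1 !code_eq ?groupM //.
move=> /eqP d2 /eqP dt d1 d't.
have [Gud Gtu] : u ^ d \in G /\ u * c ^+ 2 \in G by split; [apply: groupJ | apply: groupM].
move: uP; rewrite /Q' !inE -codeJ // -!M // -c1 !code_eq //.
case/and5P=> /eqP ut u1 u't du /andP[dtu udP].
have [Gx' Gy'] : s ^ x \in G /\ s ^ y \in G by rewrite !groupJ.
have [Gss Gsss Gxy] : [/\ s * s \in G, s * (s * s) \in G & s ^ x * s ^ y \in G].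
  by split; do ?[exact: Gs | exact: Gx' | exact: Gy' | apply: groupM].
move: s3P xyP; rewrite /ord3 -!codeJ // -!M // -c1 !code_eq // => /andP[s1 /eqP s3] /eqP xyP.
by split=> //; rewrite ?inE //; split=> //; rewrite !expgS expg0 mulg1.
Qed.

End SymmetricGroup4.

(** * Normal complements of subgroups of order 2 in S_4 *)

Section NormalComplements.

Import GroupScope.

Variables (gT : finGroupType) (G : {group gT}).
Hypothesis isoG : G \isog [set: {perm 'I_4}].

Lemma card_S4 : #|G| = 24.
Proof.
rewrite (card_isog isoG) cardsT.
by rewrite -[RHS]/(4`!) -card_Sn; apply: eq_card.
Qed.

(** Squares vanish in the quotient of order 2, and there are 12 of them. *)
Lemma index2_squares (B : {group gT}) :
  B \subset G -> #|B| = 12 -> B = [set y ^+ 2 | y in G] :> {set gT}.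
Proof.
move=> sBG cardB; apply/esym/eqP; rewrite eqEcard S4_squares // cardB leqnn andbT.
have nBG : B <| G.
  by apply: index2_normal => //; rewrite -divgS // card_S4 cardB.
apply/subsetP=> _ /imsetP[y Gy ->]; have Ny := subsetP (normal_norm nBG) y Gy.
rewrite coset_idr ?groupX // morphX //.
have <- : #|G / B| = 2 by rewrite card_quotient ?normal_norm // -divgS // card_S4 cardB.
by rewrite expg_cardG // mem_quotient.
Qed.

Lemma S4_index2 : exists2 B : {group gT}, B \subset G & #|B| = 12.
Proof.
have /isogP[f injf imf] := isog_symr isoG.
exists (f @* 'Alt_'I_4)%G; first by rewrite -imf morphimS ?subsetT.
rewrite card_injm ?subsetT //; apply/eqP.
by rewrite -(eqn_pmul2l (isT : 0 < 2)) card_Alt card_ord.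
Qed.

Lemma normal_complement_squares (H : {group gT}) : H \subset G -> #|H| = 2 ->
  has_normal_complement G H = (H :&: [set y ^+ 2 | y in G] == 1).
Proof.
move=> sHG cardH; apply/existsP/eqP=> [[N /andP[nNG /complP[HN1 HNG]]] | HB1].
  rewrite -(index2_squares (normal_sub nNG)) //; apply/eqP.
  by rewrite -(eqn_pmul2l (isT : 0 < 2)) -{1}cardH -TI_cardMg // HNG card_S4.
have [B sBG cardB] := S4_index2; rewrite -(index2_squares sBG cardB) in HB1.
exists B; apply/andP; split.
  by apply: index2_normal => //; rewrite -divgS // card_S4 cardB.
apply/complP; split=> //; apply/eqP; rewrite eqEcard mul_subG //=.
by rewrite TI_cardMg // cardH cardB card_S4.
Qed.

(** V consists of squares of elements y with y^4 = 1. There are only four of these, so V is the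
    whole set, which is stable under conjugation. *)
Lemma klein_subgroup_normal (V : {group gT}) : V \subset [set y ^+ 2 | y in G] ->
  #|V| = 4 -> exponent V %| 2 -> V <| G.
Proof.
move=> sVA cardV /exponentP expV.
have DV : V = [set y ^+ 2 | y in G & y ^+ 4 == 1] :> {set gT}.
  apply/eqP; rewrite eqEcard S4_klein // cardV leqnn andbT; apply/subsetP=> z Vz.
  have /imsetP[y Gy Dz] := subsetP sVA z Vz.
  apply/imsetP; exists y => //; rewrite inE Gy -[4]/(2 * 2)%N expgM -Dz.
  by rewrite expV ?eqxx.
apply/andP; split.
  by rewrite DV; apply/subsetP=> _ /imsetP[y + ->]; rewrite inE => /andP[Gy _]; rewrite groupX.
rewrite DV; apply/subsetP=> g Gg; rewrite inE; apply/subsetP=> _ /imsetP[_ /imsetP[y + ->] ->].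
rewrite inE => /andP[Gy /eqP y4]; rewrite conjXg; apply/imsetP; exists (y ^ g) => //.
by rewrite inE groupJ //= -conjXg y4 conj1g.
Qed.

Lemma card_complemented_order2 (V : {group gT}) :
    V \subset G -> #|V| = 4 -> exponent V %| 2 -> ~~ (V <| G) ->
  #|[set H : {group gT} | [&& H \subset V, #|H| == 2 & has_normal_complement G H]]| = 2.
Proof.
move=> sVG cardV expV2 nnV; have [B sBG cardB] := S4_index2.
have DB := index2_squares sBG cardB; have V2 := exponentP expV2.
(* Order 1 would give the product V B 48 elements; order 4 would put V inside the squares and make
   it normal. *)
have cardVB : #|V :&: B| = 2.
  have d4 : #|V :&: B| %| 4 by rewrite -cardV cardSg ?subsetIl.
  have := mul_cardG V B; rewrite cardV cardB => card48.
  have : #|V * B| <= 24 by rewrite -card_S4 subset_leq_card ?mul_subG.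
  case/(@dvdn_pfactor 2 _ 2): d4 card48 => // -[|[|[|//]]] _ DVB; rewrite DVB //.
    by rewrite muln1 => <-.
  move=> _ _; case/negP: nnV; apply: klein_subgroup_normal => //; rewrite -DB.
  by apply/setIidPl/eqP; rewrite eqEcard subsetIl cardV DVB.
have ord2 x : x \in V -> x \notin B -> #[x] = 2.
  move=> Vx nBx; apply: nt_prime_order => //; first exact: V2.
  by apply: contraNneq nBx => ->.
rewrite (_ : finset _ = [set <[x]>%G | x in V :\: B]).
  rewrite card_in_imset; first by rewrite cardsD cardV cardVB.
  move=> x y /setDP[Vx nBx] /setDP[Vy nBy] /(congr1 val) /= eq_xy.
  have : x \in <[y]> by rewrite -eq_xy cycle_id.
  by rewrite cycle2g ?ord2 // => /set2P[x1 | //]; rewrite x1 group1 in nBx.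
apply/setP=> H; rewrite inE; apply/and3P/imsetP=> [[sHV /eqP cardH] | [x /setDP[Vx nBx] ->]].
  rewrite normal_complement_squares ?(subset_trans sHV) // -DB => /eqP HB1.
  have [x Hx ox] : {x | x \in H & #[x] = 2} by apply: Cauchy; rewrite ?cardH.
  have DH : H :=: <[x]>.
    by apply/esym/eqP; rewrite eqEcard cycle_subG Hx cardH -orderE ox.
  exists x; last exact: val_inj.
  rewrite inE (subsetP sHV) // andbT; apply/negP=> Bx.
  have : x \in H :&: B by rewrite inE Hx.
  by rewrite HB1 => /set1P x1; rewrite x1 order1 in ox.
have ox := ord2 x Vx nBx; have sxV : <[x]> \subset V by rewrite cycle_subG.
split=> //; first by rewrite -orderE ox.
rewrite normal_complement_squares -?orderE ?(subset_trans sxV) // -DB.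
rewrite /= cycle2g //; apply/eqP/setP=> z; rewrite !inE.
by case: (eqVneq z 1) => [->|_] /=; rewrite ?group1 //; case: eqVneq => // ->; apply/negbTE.
Qed.

End NormalComplements.

(** * Regular subgroups normalized by S_4 *)

Section NoRegularSubgroup.

Import GroupScope.

Variables (T : finType) (X : {set T}) (x0 : T) (N P : {group {perm T}}).
Variable c : {perm T}.
Hypotheses (isoP : P \isog [set: {perm 'I_4}]) (cardX : #|X| = 12) (Xx0 : x0 \in X).
Hypotheses (regN : regular_perm_group N X) (symP : P \subset perm.Sym X).
Hypothesis nNP : P \subset 'N(N).
Hypothesis transP : {in X, forall x, exists2 g, g \in P & g x0 = x}.
Hypotheses (Pc : c \in P) (c2 : c ^+ 2 != 1) (c4 : c ^+ 4 = 1).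
Hypothesis stabP : forall g, g \in P -> (g x0 == x0) = (g \in [:: 1; c ^+ 2]).

Let t := c ^+ 2.
Let Pt : t \in P. Proof. exact: groupX. Qed.
Let t2 : t * t = 1. Proof. by rewrite -expgD. Qed.

Let XP g x : g \in P -> x \in X -> g x \in X.
Proof. by move=> /(subsetP symP); rewrite inE => /perm_closed ->. Qed.

Let XN n x : n \in N -> x \in X -> n x \in X.
Proof. by case: regN => /subsetP sN _ /sN; rewrite inE => /perm_closed ->. Qed.

Let eqN : {in N &, forall m n : {perm T}, m x0 = n x0 -> m = n}.
Proof.
move=> m n Nm Nn eq_mn; have [_ /(_ x0 (m x0) Xx0 (XN Nm Xx0))] := regN.
by case=> z [_ uz]; rewrite -(uz m) // (uz n).
Qed.

(* Left translation by the regular group identifies X with N; the orbit map   *)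
(* g |-> g x0 of P then becomes the crossed homomorphism cc.                  *)
Let cc (g : {perm T}) : {perm T} := odflt 1 [pick n in N | n x0 == g x0].

Let ccP g : g \in P -> cc g \in N /\ cc g x0 = g x0.
Proof.
move=> Pg; rewrite /cc; case: pickP => [n /andP[-> /eqP //] | noN].
have [_ /(_ x0 (g x0) Xx0 (XP Pg Xx0))[n [[Nn Dn] _]]] := regN.
by have := noN n; rewrite Nn Dn eqxx.
Qed.

Let ccN g : g \in P -> cc g \in N. Proof. by case/ccP. Qed.

Let ccM g h : g \in P -> h \in P -> cc (g * h) = cc h * cc g ^ h.
Proof.
move=> Pg Ph; have Pgh := groupM Pg Ph; have [[Ng Dg] [Nh Dh]] := (ccP Pg, ccP Ph).
have [Ngh Dgh] := ccP Pgh; apply: eqN => //.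
  by rewrite groupM ?memJ_norm // (subsetP nNP).
by rewrite Dgh !permM Dh permK Dg.
Qed.

Let cc_eq g h : g \in P -> h \in P -> cc g = cc h -> g * h^-1 \in [:: 1; t].
Proof.
move=> Pg Ph eq_gh; rewrite -stabP ?groupM ?groupV // permM.
by have [[_ <-] [_ Dh]] := (ccP Pg, ccP Ph); rewrite eq_gh Dh permK.
Qed.

Let cc_stab g : g \in [:: 1; t] -> cc g = 1.
Proof.
move=> tg; have Pg : g \in P by move: tg; rewrite !inE => /orP[] /eqP->.
have [Ng Dg] := ccP Pg; apply: eqN => //.
by rewrite perm1 Dg; apply/eqP; rewrite stabP.
Qed.

Let cc1 : cc 1 = 1. Proof. by apply: cc_stab; rewrite inE eqxx. Qed.
Let cct : cc t = 1. Proof. by apply: cc_stab; rewrite !inE eqxx orbT. Qed.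

Let cc_stabP g : g \in P -> cc g = 1 -> g \in [:: 1; t].
Proof.
by move=> Pg cg1; have := cc_eq Pg (group1 P); rewrite cg1 cc1 invg1 mulg1; apply.
Qed.

Let cc_onto n : n \in N -> exists2 g, g \in P & cc g = n.
Proof.
move=> Nn; have [g Pg Dg] := transP (XN Nn Xx0).
by exists g => //; have [Ng Dn] := ccP Pg; apply: eqN; rewrite // Dn.
Qed.

(** [cc (g * t)] is the conjugate of [cc g] by t, while [cc (t * g)] is [cc g]. If these agree, g t
    is t g or t t g, and the latter equals g, which would force t = 1. *)
Let cc_cent g : g \in P -> (cc g \in 'C[t]) = (g \in 'C[t]).
Proof.
move=> Pg; have ccgt : cc (g * t) = cc g ^ t by rewrite ccM // cct mul1g.
have cctg : cc (t * g) = cc g by rewrite ccM // cct conj1g mulg1.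
apply/cent1P/cent1P=> cgt; last first.
  by apply/commgP/conjg_fixP; rewrite -ccgt cgt cctg.
have/cc_eq : cc (g * t) = cc (t * g).
  by rewrite ccgt cctg; apply/conjg_fixP/commgP.
rewrite !groupM // => /(_ isT isT); rewrite !inE => /orP[] /eqP.
  by move/(canRL (mulgKV _)); rewrite mul1g.
move/(canRL (mulgKV _)); rewrite [X in _ = X]mulgA [X in _ = X * _]t2 mul1g => gt.
by case/eqP: c2; apply: (mulgI g); rewrite mulg1.
Qed.

Let V := 'C_N[t]%G.

(** By [cc_cent], V moves x0 through the same points as C_P(t), whose orbit has 8 / 2 points. *)
Let cardV : #|V| = 4.
Proof.
have card_stab : #|'C_('C_P[t])[x0 | 'P]| = 2.
  rewrite (_ : 'C_(_)[_ | _] = [set 1; t]) ?cards2 1?eq_sym ?c2 //.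
  apply/setP=> g; rewrite 2!in_setI (sameP astab1P eqP) /= apermE.
  apply/andP/set2P=> [[/andP[Pg _]] | tg].
    by rewrite stabP // !inE => /orP[] /eqP; [left | right].
  have Pg : g \in P by case: tg => ->.
  rewrite stabP // Pg; split; last by rewrite !inE; case: tg => ->; rewrite eqxx ?orbT.
  by apply/cent1P; case: tg => -> //; apply/commute_sym/commute1.
have := card_orbit_stab 'P 'C_P[t]%G x0.
rewrite card_stab (S4_square_cent isoP Pc c2 c4) -[8]/(4 * 2)%N => /eqP.
rewrite eqn_pmul2r // => /eqP <-.
rewrite -(card_in_imset (f := fun n : {perm T} => n x0)); last first.
  by move=> m n /setIP[Nm _] /setIP[Nn _]; apply: eqN.
apply: eq_card => z; apply/imsetP/orbitP=> [[n /setIP[Nn tn] ->] | [g /setIP[Pg tg] <-]].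
  have [g Pg Dg] := cc_onto Nn; exists g; first by rewrite inE Pg -cc_cent // Dg.
  by rewrite /= apermE -Dg; case: (ccP Pg).
by exists (cc g); [rewrite inE ccN ?cc_cent | rewrite /= apermE; case: (ccP Pg)].
Qed.

Let cardN : #|N| = 12.
Proof.
rewrite -cardX -(card_in_imset (f := fun n : {perm T} => n x0)); last exact: eqN.
apply: eq_card => x; apply/imsetP/idP=> [[n Nn ->] | Xx]; first exact: XN.
by have [_ /(_ x0 x Xx0 Xx)[n [[Nn <-] _]]] := regN; exists n.
Qed.

Let V_Ldiv4 : #|'Ldiv_4(N)| = 4 -> V = 'Ldiv_4(N) :> {set _}.
Proof.
move=> card4; apply/eqP; rewrite eqEcard card4 cardV leqnn andbT.
apply/subsetP=> v Vv; have [Nv _] := setIP Vv.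
by rewrite 2!inE Nv -cardV expg_cardG ?eqxx.
Qed.

(** The solutions of x^3 = 1 and of x^4 = 1 share only the identity, so their numbers add up to at
    most 12 + 1. If the multiple of 4 is at least 8, the multiple of 3 must be 3. *)
Let card_Ldiv4 : #|'Ldiv_4(N)| = 4.
Proof.
have d4 : 4 %| #|'Ldiv_4(N)| by apply: Frobenius_Ldiv; rewrite cardN.
have d3 : 3 %| #|'Ldiv_3(N)| by apply: Frobenius_Ldiv; rewrite cardN.
have V4 : V \subset 'Ldiv_4(N).
  by apply/subsetP=> v Vv; have [Nv _] := setIP Vv; rewrite 2!inE Nv -cardV expg_cardG ?eqxx.
have le4 := subset_leq_card V4; rewrite cardV in le4.
have le13 : #|'Ldiv_3(N)| + #|'Ldiv_4(N)| <= 13.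
  rewrite -cardsUI -[13]/(12 + 1)%N leq_add //.
    by rewrite -cardN subset_leq_card // subUset !subsetIl.
  apply: leq_trans (subset_leq_card (_ : _ \subset [set 1])) _; last by rewrite cards1.
  apply/subsetP=> x; rewrite !inE => /andP[/andP[_ /eqP x3] /andP[_]].
  by rewrite expgS x3 mulg1.
have le3 : 0 < #|'Ldiv_3(N)|.
  by apply/card_gt0P; exists 1; rewrite !inE group1 expg1n eqxx.
have [//|ne4] := eqVneq #|'Ldiv_4(N)| 4.
have card3 : #|'Ldiv_3(N)| = 3.
  case/dvdnP: d4 ne4 le4 le13 => -[|[|i]] -> //= _ _.
  by case/dvdnP: d3 le3 => -[|[|j]] -> // _; rewrite !mulSn; lia.
have [q Nq oq] : {q | q \in N & #[q] = 3} by apply: Cauchy; rewrite ?cardN.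
have Dq : <[q]> = 'Ldiv_3(N).
  apply/eqP; rewrite eqEcard card3 -orderE oq leqnn andbT; apply/subsetP=> z qz.
  rewrite 2!inE (subsetP _ _ qz) ?cycle_subG //=.
  by rewrite -oq -order_dvdn order_dvdG.
have qc : q ^ c \in <[q]>.
  rewrite Dq 2!inE memJ_norm ?Nq ?(subsetP nNP) //= -conjXg.
  by rewrite -oq expg_order conj1g eqxx.
(* c either fixes or inverts q, so its square t fixes q. *)
have qt : q ^ t = q.
  rewrite /t expgS expg1 conjgM.
  case/cyclePmin: qc => i; rewrite oq; case: i => [|[|[|//]]] _.
  - by move/(canRL (conjgK _)); rewrite conj1g => q1; rewrite q1 order1 in oq.
  - by rewrite expg1 => qc; rewrite !qc.
  move=> qc; rewrite qc conjXg qc -expgM -[(2 * 2)%N]/(3 + 1)%N expgD -oq.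
  by rewrite expg_order mul1g.
have Vq : q \in V by rewrite inE Nq; apply/cent1P/commgP/conjg_fixP.
by have := order_dvdG Vq; rewrite oq cardV.
Qed.

Let nVP : P \subset 'N(V).
Proof.
rewrite (V_Ldiv4 card_Ldiv4); apply/subsetP=> g Pg; rewrite inE.
apply/subsetP=> _ /imsetP[z + ->]; rewrite !inE => /andP[Nz /eqP z4].
by rewrite memJ_norm ?Nz ?(subsetP nNP) // -conjXg z4 conj1g eqxx.
Qed.

Lemma S4_no_regular : False.
Proof.
have [d [g [a [b [x [y]]]]]] := S4_witnesses isoP Pc c2 c4.
rewrite -/t; set u := t ^ g; set s := d ^ a * d ^ b.
case=> -[[Pd Pg Pa Pb] [Px Py]] [d2 dt d1 d't] [ut u1 u't du] [dtu udP] [s1 s3 st].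
have Pu : u \in P by rewrite groupJ.
have Ps : s \in P by rewrite groupM ?groupJ.
have nCP : P \subset 'N('C(V)) by apply: norms_cent.
have CVJ z h : h \in P -> (z ^ h \in 'C(V)) = (z \in 'C(V)).
  by move=> Ph; rewrite memJ_norm ?(subsetP nCP).
have CVt : t \in 'C(V) by rewrite -sub_cent1 subsetIr.
have CVu : u \in 'C(V) by rewrite CVJ.
have fixV z v : z \in 'C(V) -> v \in V -> v ^ z = v.
  by move=> /centP Cz Vv; apply/conjg_fixP/commgP/commute_sym/Cz.
have abV : abelian V by apply: (@card_p2group_abelian _ 2); rewrite ?cardV.
set w := cc u; set v := cc d.
have Vw : w \in V by rewrite inE ccN // cc_cent //; apply/cent1P.
have Vv : v \in V by rewrite inE ccN // cc_cent //; apply/cent1P.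
have w1 : w != 1.
  by apply/eqP => /(cc_stabP Pu); rewrite !inE (negPf u1) (negPf u't).
have v1 : v != 1.
  by apply/eqP => /(cc_stabP Pd); rewrite !inE (negPf d1) (negPf d't).
have vw : v != w.
  apply/eqP => /(cc_eq Pd Pu); rewrite !inE => /orP[] /eqP/(canRL (mulgKV _)) Dd.
    by rewrite Dd mul1g eqxx in du.
  by rewrite Dd eqxx in dtu.
have u2 : u * u = 1 by rewrite -conjMg t2 conj1g.
have w2 : w * w = 1 by rewrite -cc1 -u2 ccM // fixV.
have vd : v ^ d = v^-1.
  by apply: (mulgI v); rewrite mulgV -ccM // -[d * d]/(d ^+ 2) d2 cc1.
have ccud : cc (u ^ d) = w.
  move: udP; rewrite !inE => /orP[] /eqP -> //.
  by rewrite ccM // cct conj1g mulg1.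
(* This compares the two values of [cc] on u * d = d * u ^ d. *)
have wd : w ^ d = w.
  apply: (mulgI v); rewrite -ccM // [u * d]conjgC ccM ?groupJ // ccud fixV ?CVJ //.
  exact: (centsP abV).
(* If v^2 = 1, then V = {1, v, w, v w} is centralized by d, hence by all conjugates of d. Otherwise
   V is cyclic of order 4, its automorphism group has order 2, and s of order 3 acts trivially. *)
have CVs : s \in 'C(V).
  have [v2 | v2] := eqVneq (v * v) 1.
    suffices CVd : d \in 'C(V) by rewrite groupM ?CVJ.
    have v'v : v^-1 = v by apply: (mulgI v); rewrite mulgV v2.
    have w'w : w^-1 = w by apply: (mulgI w); rewrite mulgV w2.
    have v'w : v * w != 1.
      by apply: contra vw => /eqP/(canRL (mulgK _)); rewrite mul1g w'w => ->.
    have uniqV : uniq [:: 1; v; w; v * w].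
      rewrite /= !inE !negb_or eq_sym v1 eq_sym w1 eq_sym v'w vw /=.
      rewrite -{1}[v]mulg1 (inj_eq (mulgI v)) eq_sym w1.
      by rewrite -{1}[w]mul1g (inj_eq (mulIg w)) eq_sym v1.
    have [||_ DV] := uniq_min_size uniqV (s2 := enum V).
    - by apply/allP; rewrite /= !mem_enum groupM ?group1 // Vv Vw.
    - by rewrite -cardE cardV.
    apply/centP=> z; rewrite -mem_enum -DV !inE.
    have cdv : commute d v by apply/commute_sym/commgP/conjg_fixP; rewrite vd.
    have cdw : commute d w by apply/commute_sym/commgP/conjg_fixP.
    by case/or4P=> /eqP-> //; [apply: commute1 | apply: commuteM].
  have ov : #[v] = 4.
    have : #[v] %| 4 by rewrite -cardV order_dvdG.
    case/(@dvdn_pfactor 2 _ 2) => // -[|[|[|//]]] _ ov //.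
      by move/eqP: ov; rewrite order_eq1 (negPf v1).
    by case/eqP: v2; rewrite -[v * v]/(v ^+ 2) -[2]ov expg_order.
  have DV : V = <[v]> :> {set _}.
    by apply/esym/eqP; rewrite eqEcard cycle_subG Vv cardV -orderE ov.
  have vs3 : ((v ^ s) ^ s) ^ s = v.
    by rewrite -2!conjgM -[X in v ^ X]/(s ^+ 3) s3 conjg1.
  have Vvs : v ^ s \in <[v]> by rewrite -DV memJ_norm ?(subsetP nVP).
  rewrite DV cent_cycle; apply/cent1P/commute_sym/commgP/conjg_fixP.
  have v4 : v ^+ 4 = 1 by rewrite -ov expg_order.
  case/cyclePmin: Vvs; rewrite ov => -[|[|[|[|//]]]] _ vs.
  - by move: vs3; rewrite vs !conj1g => vE; rewrite -vE eqxx in v1.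
  - by rewrite vs.
  - by move: vs3; rewrite vs conjXg vs -expgM v4 conj1g => vE; rewrite -vE eqxx in v1.
  have v3 : v ^+ 3 = v^-1 by apply: (mulgI v); rewrite -expgS v4 mulgV.
  move: vs3; rewrite vs v3 conjVg vs v3 invgK vs v3 => vE.
  by case/eqP: v2; rewrite -{1}vE mulVg.
have CNs : s \in 'C(N).
  have CVN : V \subset 'C_N[s] by rewrite subsetI subsetIl sub_cent1.
  have d4 : 4 %| #|'C_N[s]| by rewrite -cardV cardSg.
  have os : #[s] = 3 by apply: nt_prime_order.
  (* The 3-group generated by s acts on the 12 elements of N, so its fixed points number 0 modulo
     3. *)
  have d3 : 3 %| #|'C_N[s]|.
    have pS : 3.-group <[s]> by rewrite /pgroup -orderE os pnat_id.
    have aN : [acts <[s]>, on N | 'J].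
      by rewrite astabsJ cycle_subG (subsetP nNP).
    have := pgroup_fix_mod pS aN; rewrite afixJ cent_cycle cardN => /eqP.
    by rewrite eq_sym.
  have d12 : 12 %| #|'C_N[s]| by rewrite (@Gauss_dvd 3 4) ?d3.
  rewrite -sub_cent1; apply/setIidPl/eqP; rewrite eqEcard subsetIl cardN.
  by rewrite dvdn_leq // cardG_gt0.
have CNJ z h : h \in P -> z \in 'C(N) -> z ^ h \in 'C(N).
  by move=> Ph; rewrite memJ_norm ?(subsetP (norms_cent nNP)).
have : t \in 'C(N) by rewrite -st groupM ?CNJ.
rewrite -sub_cent1 => /setIidPl VN.
by have := cardV; rewrite /= VN cardN.
Qed.

End NoRegularSubgroup.

(** * Translations of cosets *)

Section Translations.

Import GroupScope.

Variables (gT : finGroupType) (G H : {group gT}).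
Hypothesis sHG : H \subset G.

Local Notation tr := (actperm <[actsRs_rcosets H G]>).
Local Notation X := (rcosets H G).

Lemma translationE g x : g \in G -> x \in X -> tr g x = x :* g.
Proof. by move=> Gg Xx; rewrite actpermE actbyE //= rcosetE. Qed.

Lemma translation_rcoset g a : a \in G -> g \in G -> tr g (H :* a) = H :* (a * g).
Proof. by move=> Ga Gg; rewrite translationE ?mem_rcosets ?mulSGid ?rcosetM // mem_rcosets. Qed.

Lemma translation_on g : perm_on X (tr g).
Proof.
apply/subsetP=> x; apply: contraR => nXx.
by rewrite actpermE /= /actby (negPf nXx).
Qed.

Lemma group_in_rcosets : (H : {set gT}) \in X.
Proof. by apply/rcosetsP; exists 1; rewrite ?group1 ?mulg1. Qed.

Lemma translation_fix g : g \in G -> (tr g H == H) = (g \in H).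
Proof.
move=> Gg; rewrite translationE ?group_in_rcosets //.
by apply/eqP/idP=> [<- | /rcoset_id //]; apply: rcoset_refl.
Qed.

Lemma ker_translation_sub : 'ker tr \subset H.
Proof.
apply/subsetP=> g /morphpreP[Gg /set1P/permP/(_ (H : {set gT}))].
by rewrite perm1 => /eqP; rewrite translation_fix.
Qed.

(** Regular groups of translations are the images of normal complements. Regularity at the base
    coset H says that the preimage of N meets H trivially, and transitivity there says that it
    generates G with H. *)
Lemma regular_translationsP : 'ker tr = 1 ->
  reflect (exists N : {group {perm {set gT}}},
             [/\ regular_perm_group N X, translations G H \subset 'N(N)
               & N \subset translations G H])
          (has_normal_complement G H).
Proof.
move=> ker1; apply: (iffP existsP) => [[M /andP[nMG /complP[MH1 MHG]]] | [N]].
  have sMG := normal_sub nMG.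
  have X_M x : x \in X -> exists2 m, m \in M & x = H :* m.
    case/rcosetsP=> a + ->; rewrite -MHG => /mulsgP[h m Hh Mm ->].
    by exists m; rewrite // rcosetM rcoset_id.
  exists (tr @* M)%G; split; last 2 first.
  - by rewrite morphim_norms // normal_norm.
  - by rewrite morphimS.
  split=> [|x y /X_M[m Mm ->] /X_M[n Mn ->]].
    by apply/subsetP=> _ /morphimP[g _ _ ->]; rewrite inE translation_on.
  have [Gm Gn] := (subsetP sMG m Mm, subsetP sMG n Mn).
  exists (tr (m^-1 * n)); split=> [|_ [/morphimP[g _ Mg ->]]].
    split; first by rewrite mem_morphim ?groupM ?groupV.
    by rewrite translation_rcoset ?groupM ?groupV // mulKVg.
  have Gg := subsetP sMG g Mg.
  rewrite translation_rcoset // => eq_H; congr (tr _).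
  have : m * g * n^-1 \in H :&: M.
    by rewrite in_setI -mem_rcoset -eq_H rcoset_refl /= !(@groupM _ M) ?groupV.
  rewrite MH1 => /set1P/(canRL (mulgKV _)); rewrite mul1g => <-.
  by rewrite mulKg.
case=> -[sNX regN] nNtr sNtr.
have nNG : tr @*^-1 N <| G.
  apply/andP; split; first exact: subsetIl.
  by apply: subset_trans (morphpre_norms _ nNtr); rewrite -sub_morphim_pre.
exists (tr @*^-1 N)%G; rewrite nNG; apply/complP; split.
  apply/trivgP; rewrite -ker1; apply/subsetP=> g /setIP[Hg /morphpreP[Gg Ng]].
  apply/kerP => //; have [n [_ un]] := regN _ _ group_in_rcosets group_in_rcosets.
  transitivity n; last by apply: un; rewrite group1 perm1.
  by symmetry; apply: un; split=> //; apply/eqP; rewrite translation_fix.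
apply/eqP; rewrite eqEsubset mul_subG ?(normal_sub nNG) //=; apply/subsetP=> g Gg.
have Xg : H :* g \in X by rewrite mem_rcosets mulSGid.
have [n [[Nn Dm] _]] := regN _ _ group_in_rcosets Xg.
have /morphimP[m _ Gm Dn] := subsetP sNtr n Nn; rewrite {n}Dn in Nn Dm.
have : g \in H :* m.
  by rewrite -(translationE Gm group_in_rcosets) Dm rcoset_refl.
by case/rcosetP=> h Hh ->; apply: mem_mulg => //; apply: mem_morphpre.
Qed.


End Translations.

(** * The coset action of S_4 modulo the square of a 4-cycle *)

Section TranslationsS4.

Import GroupScope.

Lemma S4_translations_no_regular (gT : finGroupType) (G H : {group gT}) c
    (N : {group {perm {set gT}}}) :
    G \isog [set: {perm 'I_4}] -> c \in G -> #[c] = 4 -> H :=: <[c ^+ 2]> ->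
    'ker (actperm <[actsRs_rcosets H G]>) = 1 ->
    regular_perm_group N (rcosets H G) -> translations G H \subset 'N(N) ->
  False.
Proof.
move=> isoG Gc oc DH ker1 regN nN.
have sHG : H \subset G by rewrite DH cycle_subG groupX.
pose tr := actperm_morphism <[actsRs_rcosets H G]>.
have injtr : 'injm tr by apply/trivgP.
have oc2 : #[c ^+ 2] = 2 by rewrite orderXdiv oc.
have isoP : translations G H \isog [set: {perm 'I_4}].
  by apply: isog_trans isoG; rewrite isog_sym; apply: (sub_isog (subxx G) injtr).
have cardX : #|rcosets H G| = 12.
  by rewrite -[LHS]/#|G : H| -divgS // (card_S4 isoG) DH -orderE oc2.
have symP : translations G H \subset perm.Sym (rcosets H G).
  by apply/subsetP=> _ /morphimP[g _ _ ->]; rewrite inE translation_on.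
have trX n : tr c ^+ n = tr (c ^+ n) by rewrite morphX.
have tr_eq1 g : g \in G -> (tr g == 1) = (g == 1).
  by move=> Gg; rewrite -(morph1 tr) (inj_in_eq (injmP injtr)) ?group1.
apply: (@S4_no_regular _ (rcosets H G) H N (translations G H) (tr c)
  isoP cardX (group_in_rcosets G H) regN symP nN).
- move=> _ /rcosetsP[g Gg ->]; exists (tr g); first by rewrite mem_morphim.
  by rewrite -[RHS](translationE _ (group_in_rcosets G H)).
- by rewrite mem_morphim.
- by rewrite trX tr_eq1 ?groupX // -order_eq1 oc2.
- by rewrite trX -oc expg_order morph1.
move=> _ /morphimP[g _ Gg ->]; rewrite trX.
transitivity (g \in <[c ^+ 2]>); first by rewrite -DH; apply: translation_fix.
rewrite cycle2g // !inE tr_eq1 //; congr (_ || _).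
by rewrite (inj_in_eq (injmP injtr)) ?groupX.
Qed.

End TranslationsS4.

(** * Galois correspondence *)

Section GaloisClosure.

Variables (k : fieldType) (L : splittingFieldType k).
Implicit Types K E F M : {subfield L}.

(** The fixed field of A is Galois because A is normal, and it contains K, so by minimality it
    contains E. *)
Lemma galois_closure_core_trivial K E (A : {group gal_of E}) :
    galois_closure K E -> (A <| 'Gal(E / 1))%g -> A \subset 'Gal(E / K)%g ->
  A :=: 1%g.
Proof.
case=> sKE gal1E minE nAG sAK; apply/trivgP/subsetP=> x Ax.
have sEA : (E <= fixedField A)%VS.
  apply: (minE (fixedField_aspace A)); last exact: normal_fixedField_galois nAG.
  by rewrite -galois_connection.
apply/set1P/eqP/gal_eqP=> a /(subvP sEA)/mem_fixedFieldP[_ fixA].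
by rewrite gal_id fixA.
Qed.

Lemma galois_closure_between K E F :
  galois_closure K E -> (K <= F <= E)%VS -> galois_closure F E.
Proof.
case=> _ gal1E minE /andP[sKF sFE]; split=> // M sFM; apply: minE.
exact: subv_trans sKF sFM.
Qed.

Lemma galois_closure_unique K E F :
  galois_closure K E -> galois_closure K F -> E = F.
Proof.
case=> sKE galE minE [sKF galF minF]; apply/val_inj/eqP => /=.
by rewrite eqEsubv minE ?minF.
Qed.

Lemma ker_translation_closure K E : galois_closure K E ->
  ('ker (actperm <[actsRs_rcosets 'Gal(E / K) 'Gal(E / 1)]>) = 1)%g.
Proof.
move=> closE; apply: (galois_closure_core_trivial closE (ker_normal _)).
by apply: ker_translation_sub; apply: galS; apply: sub1v.
Qed.

Lemma almost_classically_galoisP F E : galois_closure F E ->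
  reflect (almost_classically_galois F) (has_normal_complement 'Gal(E / 1) 'Gal(E / F)).
Proof.
move=> closE; have sFG : ('Gal(E / F) \subset 'Gal(E / 1))%g by apply: galS; apply: sub1v.
apply: (iffP (regular_translationsP sFG (ker_translation_closure closE))).
  by exists E; split.
by case=> E' [/(galois_closure_unique closE) <-].
Qed.

Lemma hopf_galois_regular_rcosets F E : galois_closure F E -> hopf_galois (subvs_of F) ->
  exists N : {group {perm {set gal_of E}}},
    regular_perm_group N (rcosets 'Gal(E / F) 'Gal(E / 1))
    /\ translations 'Gal(E / 1) 'Gal(E / F) \subset 'N(N)%g.
Proof.
move=> closE; have [sFE gal1E minE] := closE.
set G := ('Gal(E / 1))%G; set H := ('Gal(E / F))%G.
have sHG : H \subset G by apply: galS; apply: sub1v.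
(* A coset H g names the restriction of g to F; the chosen representative is immaterial because H
   fixes F. *)
pose e (x : {set gal_of E}) : 'AHom(subvs_of F, L) :=
  linfun_ahom ((repr x : 'AEnd(L)) \o vsval : {lrmorphism subvs_of F -> L}).
have eE g a : e (H :* g)%g a = g (vsval a).
  rewrite /e /= lfunE /=; case: repr_rcosetP => h Hh.
  by rewrite galM ?(subvP sFE) ?subvsP // (fixed_gal sFE Hh) ?subvsP.
have inj_e : {in rcosets H G &, injective e}.
  move=> _ _ /rcosetsP[g Gg ->] /rcosetsP[h Gh ->] eq_e.
  apply: rcoset_eqP; rewrite mem_rcoset gal_kHom //; apply/kAHomP=> a Fa.
  have Ea := subvP sFE a Fa.
  have := congr1 (fun f : 'AHom(subvs_of F, L) => f (vsproj F a)) eq_e.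
  rewrite !eE vsprojK // galM // => ->.
  by rewrite -galM // mulgV gal_id.
(* Since E is normal, every embedding of F into L extends to an automorphism of E. *)
have surj_e f : exists2 x, x \in rcosets H G & e x = f.
  pose phi := (f \o linfun (vsproj F))%VF.
  have phiE a : phi a = f (vsproj F a) by rewrite comp_lfunE lfunE.
  have phiH : kHom 1 F phi.
    rewrite k1HomE; apply/ahom_inP; split=> [a b Fa Fb|].
      rewrite !phiE -rmorphM; congr (f _); apply: val_inj.
      by rewrite /= !vsprojK ?rpredM.
    rewrite phiE -[RHS](rmorph1 f); congr (f _); apply: val_inj.
    by rewrite /= vsprojK ?mem1v ?algid1.
  have [_ _ nor1E] := and3P gal1E.
  have [|x Gx Dx] := kHom_to_gal _ nor1E phiH; first by rewrite sub1v.
  exists (H :* x)%g; first by rewrite mem_rcosets mulSGid.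
  apply/val_inj/lfunP=> a /=; rewrite -[LHS]/(e _ a) eE -Dx ?subvsP // phiE.
  by rewrite vsvalK.
have X0 : rcosets H G != set0 by apply/set0Pn; exists (H : {set _}); apply: group_in_rcosets.
case/(hopf_galois_regular inj_e surj_e X0) => N [regN nN]; exists N; split=> //.
apply/subsetP=> _ /morphimP[g _ Gg ->]; apply: (nN g); first exact: translation_on.
move=> _ /rcosetsP[a Ga ->]; rewrite /= translation_rcoset //.
apply/val_inj/lfunP=> z /=; rewrite -[LHS]/(e _ z) eE comp_lfunE.
rewrite [in RHS](eE a z : ahval (e _) z = _).
by rewrite galM // (subvP sFE) ?subvsP.
Qed.

End GaloisClosure.

(** * Intermediate fields of an extension with group S_4 *)

Section S4Extension.

Variables (k : fieldType) (L : splittingFieldType k) (K E : {subfield L}).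
Hypotheses (closE : galois_closure K E).
Hypothesis isoG : 'Gal(E / 1)%g \isog [set: {perm 'I_4}].

Local Notation G := ('Gal(E / 1))%G.

Let sKE : (K <= E)%VS. Proof. by case: closE. Qed.
Let galE : galois 1 E. Proof. by case: closE. Qed.

Let sub_gal (F : {subfield L}) : ('Gal(E / F) \subset G)%g.
Proof. by apply: galS; apply: sub1v. Qed.

Lemma galois_above (F : {subfield L}) : (F <= E)%VS -> galois F E.
Proof. by move=> sFE; apply: galoisS galE; rewrite sub1v. Qed.

Lemma dim_mul_card_gal (F : {subfield L}) : (F <= E)%VS ->
  (\dim F * #|'Gal(E / F)%g| = 24)%N.
Proof.
move=> sFE; rewrite -galois_dim ?galois_above // mulnC divnK ?field_dimS //.
have := galois_dim galE; rewrite dimv1 divn1 => ->; exact: card_S4 isoG.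
Qed.

Lemma fixedField_gal (F : {subfield L}) : (F <= E)%VS ->
  F = fixedField_aspace ('Gal(E / F))%G.
Proof.
by move=> sFE; apply/val_inj/esym/galois_fixedField; apply: galois_above.
Qed.

Lemma sub_fixedField (A : {group gal_of E}) :
  (A \subset 'Gal(E / K))%g -> (K <= fixedField_aspace A <= E)%VS.
Proof. by move=> sA; rewrite /= fixedField_bound -galois_connection // sA. Qed.

Lemma gal_klein_not_normal : ('Gal(E / K) != 1 -> ~~ ('Gal(E / K) <| G))%g.
Proof. 
by apply: contra => nKG; apply/eqP/(galois_closure_core_trivial closE nKG).
Qed.

Lemma S4_klein_case : 'Gal(E / K)%g \isog [set: 'Z_2 * 'Z_2] ->
  #|[set H : {group gal_of E} |
          [&& H \subset 'Gal(E / K)%g, #|H| == 2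
            & has_normal_complement 'Gal(E / 1) H]]| = 2
     /\ exists F1 F2 : {subfield L},
          F1 <> F2
          /\ forall F : {subfield L},
               ([/\ (K <= F)%VS, (F <= E)%VS, \dim F = 12
                  & almost_classically_galois F]
                <-> F = F1 \/ F = F2).
Proof.
move=> isoV; have cardV : #|'Gal(E / K)%g| = 4.
  by rewrite (card_isog isoV) cardsT card_prod card_ord.
have expV : (exponent 'Gal(E / K) %| 2)%N.
  rewrite (exponent_isog isoV); apply/exponentP=> -[a b] _.
  have sq1 (z : 'Z_2) : (z * z)%g = 1%g by case: z => [[|[|//]] ltz]; apply: val_inj.
  by change ((a * a, b * b) = (1, 1))%g; rewrite !sq1.
have nnV : ~~ ('Gal(E / K) <| G)%g.
  by apply: gal_klein_not_normal; rewrite -cardG_gt1 cardV.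
have card2 := card_complemented_order2 isoG (sub_gal K) cardV expV nnV.
split=> //; have /eqP/cards2P[H1 [H2 [neH DS]]] := card2.
have inS H : H \in [set H1; H2] -> [/\ (H \subset 'Gal(E / K))%g, #|H| = 2
    & has_normal_complement G H].
  by rewrite -DS inE => /and3P[? /eqP ? ?].
exists (fixedField_aspace H1), (fixedField_aspace H2); split.
  move/(congr1 (fun F : {subfield L} => 'Gal(E / F)%g)) => /=.
  by rewrite !gal_fixedField => /group_inj; apply/eqP.
have good H : H \in [set H1; H2] -> let F := fixedField_aspace H in
    [/\ (K <= F)%VS, (F <= E)%VS, \dim F = 12 & almost_classically_galois F].
  case/inS=> sHV cardH ncH F; have /andP[sKF sFE] := sub_fixedField sHV.
  split=> //; first apply/eqP.
    have /eqP := dim_mul_card_gal sFE.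
    by rewrite gal_fixedField cardH -[24]/(12 * 2)%N eqn_pmul2r.
  have closF : galois_closure F E by apply: galois_closure_between closE _; rewrite sKF.
  by apply/(almost_classically_galoisP closF); rewrite (group_inj (gal_fixedField H)).
move=> F; split=> [[sKF sFE dimF acF] | [] ->]; last 2 first.
- by apply: good; rewrite !inE eqxx.
- by apply: good; rewrite !inE eqxx orbT.
have closF : galois_closure F E by apply: galois_closure_between closE _; rewrite sKF.
have : ('Gal(E / F))%G \in [set H1; H2].
  rewrite -DS inE galS //=; apply/andP; split.
    have /eqP := dim_mul_card_gal sFE.
    by rewrite dimF -[24]/(12 * 2)%N eqn_pmul2l.
  exact/(almost_classically_galoisP closF).
by move=> /set2P[] <-; [left | right]; apply: fixedField_gal.
Qed.

Lemma S4_cyclic_case : \dim K = 6 -> cyclic 'Gal(E / K)%g ->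
  exists F : {subfield L},
        unique (fun F' : {subfield L} =>
                  [/\ (K <= F')%VS, K <> F', (F' <= E)%VS & F' <> E]) F
        /\ ~ hopf_galois (subvs_of F).
Proof.
move=> degK cycV.
have cardV : #|'Gal(E / K)%g| = 4.
  have /eqP := dim_mul_card_gal sKE.
  by rewrite degK -[24]/(6 * 4)%N eqn_pmul2l // => /eqP.
have [c Dc] := cyclicP cycV.
have oc : #[c]%g = 4 by rewrite orderE -Dc.
have oc2 : #[c ^+ 2]%g = 2 by rewrite orderXdiv oc.
have Vc : c \in 'Gal(E / K)%g by rewrite Dc cycle_id.
pose F := fixedField_aspace <[c ^+ 2]>%G.
have galF : ('Gal(E / F) = <[c ^+ 2]>)%g := gal_fixedField _.
have sHV : (<[c ^+ 2]> \subset 'Gal(E / K))%g by rewrite cycle_subG groupX.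
have /andP[sKF sFE] := sub_fixedField sHV.
have galEE : #|'Gal(E / E)%g| = 1%N.
  by rewrite -galois_dim ?galois_above // divnn adim_gt0.
exists F; split; last first.
  have closF : galois_closure F E by apply: galois_closure_between closE _; rewrite sKF.
  case/(hopf_galois_regular_rcosets closF) => N [regN nN].
  apply: (S4_translations_no_regular isoG _ oc galF _ regN nN).
    exact: (subsetP (sub_gal K)).
  exact: ker_translation_closure closF.
split; first split=> //.
- by move=> eqF; have := cardV; rewrite eqF galF -orderE oc2.
- move/(congr1 (fun M : {subfield L} => #|'Gal(E / M)%g|)).
  by rewrite galEE galF -orderE oc2.
move=> F' [sKF' neKF' sF'E neF'E].
rewrite (fixedField_gal sF'E) /F; congr fixedField_aspace.
(* A subgroup of a cyclic group is determined by its order; orders 1 and 4 belong to the excluded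
   fields E and K. *)
apply/eqP; rewrite (eq_subG_cyclic cycV) ?galS // -orderE oc2.
have : (#|'Gal(E / F')| %| 4)%g by rewrite -cardV cardSg ?galS.
case/(@dvdn_pfactor 2 _ 2) => // -[|[|[|//]]] _ cardF' //; last 2 first.
- by rewrite cardF'.
- case: neKF'; rewrite (fixedField_gal sKE) (fixedField_gal sF'E); congr fixedField_aspace.
  by apply/esym/eqP; rewrite eqEcard galS //= cardF' cardV.
case: neF'E; rewrite (fixedField_gal sF'E) [RHS](fixedField_gal (subvv E)).
congr fixedField_aspace; apply/esym/eqP.
by rewrite eqEcard galS //= cardF' galEE.
Qed.

End S4Extension.

Theorem proposition4p6 (k : fieldType) (L : splittingFieldType k)
    (K E : {subfield L})
    (sepK : separable 1 K)
    (degK : \dim K = 6)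
    (closE : galois_closure K E)
    (galS4 : 'Gal(E / 1) \isog [set: {perm 'I_4}]) :
  ('Gal(E / K) \isog [set: 'Z_2 * 'Z_2] ->
     #|[set H : {group gal_of E} |
          [&& H \subset 'Gal(E / K)%g, #|H| == 2
            & has_normal_complement 'Gal(E / 1) H]]| = 2
     /\ exists F1 F2 : {subfield L},
          F1 <> F2
          /\ forall F : {subfield L},
               ([/\ (K <= F)%VS, (F <= E)%VS, \dim F = 12
                  & almost_classically_galois F]
                <-> F = F1 \/ F = F2))
  /\ (cyclic 'Gal(E / K) ->
      exists F : {subfield L},
        unique (fun F' : {subfield L} =>
                  [/\ (K <= F')%VS, K <> F', (F' <= E)%VS & F' <> E]) F
        /\ ~ hopf_galois (subvs_of F)).
Proof.
by split; [apply: S4_klein_case | apply: S4_cyclic_case].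
Qed.
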